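(* Let $\mathbb{F}$ be a field and let $A=[a_{ij}]$ be an $N\times M$ matrix over $\mathbb{F}$ whose null space has basis $\{v^1,\dots,v^r\}$. Let $g^{(L)}:\{1,\dots,N\}\to\mathbb{F}$ and $g^{(R)}:\{1,\dots,M\}\to\mathbb{F}$ be functions such that $g(i,j)=g^{(L)}(i)\,g^{(R)}(j)\neq 0$ for all $i,j$, and let $B=[b_{ij}]$ be the $N\times M$ matrix with $b_{ij}=a_{ij}/g(i,j)$. Then a basis for the null space of $B$ is given by the vectors $v'^1,\dots,v'^r$ with components $(v'^i)_j=(v^i)_j\,g^{(R)}(j)$ for $1\le j\le M$.
   Context: The null space of an $N\times M$ matrix $A$ over $\mathbb{F}$ is $\{v\in\mathbb{F}^M: Av=0\}$; $(v)_j$ denotes the $j$-th component of $v$. *)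

(* Defs.v *)
From mathcomp Require Import all_boot all_order all_algebra.

Set Implicit Arguments.
Unset Strict Implicit.
Unset Printing Implicit Defensive.

Import GRing.Theory.
Local Open Scope ring_scope.

Definition null_space (F : fieldType) (N M : nat) (A : 'M[F]_(N, M)) :
    {vspace 'cV[F]_M} :=
  lker (linfun (mulmx A : 'cV[F]_M -> 'cV[F]_N)).

Lemma mem_null_space (F : fieldType) (N M : nat) (A : 'M[F]_(N, M))
    (v : 'cV[F]_M) :
  (v \in null_space A) = (A *m v == 0).
Proof. by rewrite memv_ker lfunE. Qed.

(* Main.v *)
Require Import Defs.
From mathcomp Require Import all_boot all_order all_algebra.

Set Implicit Arguments.
Unset Strict Implicit.
Unset Printing Implicit Defensive.

Import GRing.Theory.
Local Open Scope ring_scope.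

(** Scaling row i by gL i and column j by gR j turns B into A; in matrix form
    B *m P = Q *m A, where P is the diagonal matrix of gR and Q the diagonal
    matrix of the inverses of gL.  As no product gL i * gR j vanishes, P and Q
    are invertible (for M = 0 nothing constrains gL, and Q has to be adjusted).
    Hence B (P x) = 0 exactly when A x = 0, so that multiplication by P is an
    isomorphism from the null space of A onto that of B ([null_space_equiv]).
    Such a map sends a basis to a basis ([basis_null_space_equiv]), and P x is
    x with its components multiplied by those of gR. *)

Lemma diag_mx_unit (F : fieldType) (n : nat) (d : 'rV[F]_n) :
  (forall j, d 0 j != 0) -> diag_mx d \in unitmx.
Proof.
by move=> d0; rewrite unitmxE det_diag unitfE; apply/prodf_neq0 => j _.
Qed.

(** Invertibility of Q gives the inclusion of the null space of B in the image,
    that of P makes every column w of the form P x. *)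
Lemma null_space_equiv (F : fieldType) (N M : nat) (A B : 'M[F]_(N, M))
    (P : 'M[F]_M) (Q : 'M[F]_N) :
    P \in unitmx -> Q \in unitmx -> B *m P = Q *m A ->
  (linfun (mulmx P : 'cV[F]_M -> 'cV[F]_M) @: null_space A)%VS = null_space B.
Proof.
move=> uP uQ BP; apply/vspaceP => w; rewrite mem_null_space.
apply/memv_imgP/eqP => [[x] | Bw0].
  rewrite mem_null_space => /eqP Ax0 ->.
  by rewrite lfunE /= mulmxA BP -mulmxA Ax0 mulmx0.
exists (invmx P *m w); last by rewrite lfunE /= mulKVmx.
(* Cancel Q on the left: Q A P^-1 w = B w = 0. *)
rewrite mem_null_space -(inj_eq (can_inj (mulKmx uQ))) mulmx0.
by rewrite (mulmxA Q) -BP -mulmxA mulKVmx // Bw0.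
Qed.

Lemma basis_null_space_equiv (F : fieldType) (N M : nat) (A B : 'M[F]_(N, M))
    (P : 'M[F]_M) (Q : 'M[F]_N) (X : seq 'cV[F]_M) :
    P \in unitmx -> Q \in unitmx -> B *m P = Q *m A ->
  basis_of (null_space A) X -> basis_of (null_space B) (map (mulmx P) X).
Proof.
move=> uP uQ BP bX; rewrite -(null_space_equiv uP uQ BP).
have -> : map (mulmx P) X
    = map (linfun (mulmx P : 'cV[F]_M -> 'cV[F]_M)) X.
  by apply: eq_map => x; rewrite lfunE.
apply: limg_basis_of bX; apply/eqP; rewrite -subv0.
apply/subvP => x; rewrite memv_cap mem_null_space memv_ker lfunE /= memv0.
by case/andP=> _ /eqP Px0; rewrite -(mulKmx uP x) Px0 mulmx0.
Qed.

(* The assumption 0 < N is implicit in speaking of an N x M matrix: for N = 0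
   the non-vanishing hypothesis would be vacuous and gR could have zeros. *)
Theorem corollaryA2p1 (F : fieldType) (N M r : nat) (hN : (0 < N)%N)
    (A B : 'M[F]_(N, M)) (v : r.-tuple 'cV[F]_M)
    (hv : basis_of (null_space A) v)
    (gL : 'I_N -> F) (gR : 'I_M -> F) (g : 'I_N -> 'I_M -> F)
    (hg : forall (i : 'I_N) (j : 'I_M), g i j = gL i * gR j)
    (hg0 : forall (i : 'I_N) (j : 'I_M), g i j != 0)
    (hB : forall (i : 'I_N) (j : 'I_M), B i j = A i j / g i j) :
  basis_of (null_space B)
    [tuple (\col_(j < M) (tnth v k j 0 * gR j) : 'cV[F]_M) | k < r].
Proof.
have gLR i j : (gL i != 0) && (gR j != 0).
  by rewrite -negb_or -mulf_eq0 -hg.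
(* With M = 0 the function gL may vanish, but then A and B are empty and any
   invertible Q will do; hence the default value 1 in Q. *)
pose P := diag_mx (\row_j gR j).
pose Q := diag_mx (\row_i (if gL i == 0 then 1 else (gL i)^-1)).
have uP : P \in unitmx.
  by apply: diag_mx_unit => j; rewrite mxE; case/andP: (gLR (Ordinal hN) j).
have uQ : Q \in unitmx.
  apply: diag_mx_unit => i; rewrite mxE.
  by case: ifP => [_ | /negbT gLi]; rewrite ?oner_eq0 ?invr_eq0.
have BP : B *m P = Q *m A.
  apply/matrixP => i j; rewrite mul_mx_diag mul_diag_mx !mxE hB hg.
  have /andP[gLi gRj] := gLR i j.
  by rewrite (negPf gLi) invfM mulrA divfK // mulrC.
have -> : tval [tuple (\col_(j < M) (tnth v k j 0 * gR j) : 'cV[F]_M) | k < r]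
    = map (mulmx P) v.
  rewrite -[RHS]/(tval [tuple of map (mulmx P) v]); congr (tval _).
  apply: eq_from_tnth => k; rewrite tnth_mktuple tnth_map.
  by apply/colP => j; rewrite mul_diag_mx !mxE mulrC.
exact: basis_null_space_equiv uP uQ BP hv.
Qed.
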